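(* Let $X$ be a Polish space and $(f_n)_n$ a sequence of real-valued Borel functions on $X$ such that the closure $\mathcal K$ of $\{f_n:n\in\mathbb N\}$ in $\mathbb R^X$ (pointwise topology) is compact and every accumulation point of $\mathcal K$ is a Baire-1 function. Then $$\sup\{\alpha(f):f\in \mathrm{Acc}(\mathcal K)\}<\omega_1,$$ where $\mathrm{Acc}(\mathcal K)$ is the set of accumulation points of $\mathcal K$. In particular, if $\mathcal K$ is a separable Rosenthal compact on $X$, then $\sup\{\alpha(f):f\in\mathcal K\}<\omega_1$.
   Context: A Rosenthal compact on a Polish space $X$ is a set of real-valued Baire-1 functions on $X$ compact in the pointwise topology; separable means having a countable dense subset. Separation rank: for $f:X\to\mathbb R$, reals $a<b$ and closed $F\subseteq X$, $F'_{f,a,b}=\overline{F\cap[f<a]}\cap\overline{F\cap[f>b]}$; iterate transfinitely ($F^{(0)}=F$, successor = derivative, intersections at limits); $\alpha(f,F,a,b)$ is the least $\xi$ with $F^{(\xi)}_{f,a,b}=\varnothing$ if one exists below $\omega_1$, else $\omega_1$; $\alpha(f,a,b)=\alpha(f,X,a,b)$ and $\alpha(f)=\sup\{\alpha(f,a,b):a,b\in\mathbb Q,\ a<b\}$. *)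

(* Defs.v *)
From Stdlib Require Import Reals QArith Qreals List.
Open Scope R_scope.

Definition is_metric {X : Type} (d : X -> X -> R) : Prop :=
  (forall x y, 0 <= d x y) /\
  (forall x y, d x y = 0 <-> x = y) /\
  (forall x y, d x y = d y x) /\
  (forall x y z, d x z <= d x y + d y z).

Definition cauchy_seq {X : Type} (d : X -> X -> R) (u : nat -> X) : Prop :=
  forall eps, eps > 0 -> exists N, forall n m, (n >= N)%nat -> (m >= N)%nat ->
    d (u n) (u m) < eps.

Definition seq_converges {X : Type} (d : X -> X -> R) (u : nat -> X) (x : X) : Prop :=
  forall eps, eps > 0 -> exists N, forall n, (n >= N)%nat -> d (u n) x < eps.

Definition mclosure {X : Type} (d : X -> X -> R) (A : X -> Prop) : X -> Prop :=
  fun x => forall eps, eps > 0 -> exists y, A y /\ d x y < eps.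

Definition is_polish {X : Type} (d : X -> X -> R) : Prop :=
  is_metric d /\
  (forall u : nat -> X, cauchy_seq d u -> exists x, seq_converges d u x) /\
  (exists s : nat -> X, forall x, mclosure d (fun y => exists n, y = s n) x).

Definition mopen {X : Type} (d : X -> X -> R) (A : X -> Prop) : Prop :=
  forall x, A x -> exists eps, eps > 0 /\ forall y, d x y < eps -> A y.

Inductive borel {X : Type} (d : X -> X -> R) : (X -> Prop) -> Prop :=
| borel_open : forall A, mopen d A -> borel d A
| borel_compl : forall A, borel d A -> borel d (fun x => ~ A x)
| borel_cunion : forall A : nat -> X -> Prop,
    (forall n, borel d (A n)) -> borel d (fun x => exists n, A n x)
| borel_ext : forall A B, borel d A -> (forall x, A x <-> B x) -> borel d B.

(** preimages of open intervals are Borel (equivalently, of open sets) *)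
Definition borel_fun {X : Type} (d : X -> X -> R) (f : X -> R) : Prop :=
  forall a b : R, borel d (fun x => a < f x < b).

Definition mcontinuous {X : Type} (d : X -> X -> R) (f : X -> R) : Prop :=
  forall x eps, eps > 0 -> exists delta, delta > 0 /\
    forall y, d x y < delta -> Rabs (f y - f x) < eps.

Definition baire1 {X : Type} (d : X -> X -> R) (f : X -> R) : Prop :=
  exists g : nat -> X -> R, (forall n, mcontinuous d (g n)) /\
    forall x, Un_cv (fun n => g n x) (f x).

Definition pw_nbhd {X : Type} (g : X -> R) (l : list X) (eps : R) : (X -> R) -> Prop :=
  fun h => forall x, In x l -> Rabs (h x - g x) < eps.

Definition pw_closure {X : Type} (S : (X -> R) -> Prop) : (X -> R) -> Prop :=
  fun g => forall (l : list X) eps, eps > 0 -> exists h, S h /\ pw_nbhd g l eps h.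

Definition pw_open {X : Type} (U : (X -> R) -> Prop) : Prop :=
  forall g, U g -> exists (l : list X) eps, eps > 0 /\ forall h, pw_nbhd g l eps h -> U h.

Definition pw_compact {X : Type} (K : (X -> R) -> Prop) : Prop :=
  forall (I : Type) (U : I -> (X -> R) -> Prop),
    (forall i, pw_open (U i)) ->
    (forall g, K g -> exists i, U i g) ->
    exists l : list I, forall g, K g -> exists i, In i l /\ U i g.

Definition pw_acc {X : Type} (K : (X -> R) -> Prop) : (X -> R) -> Prop :=
  fun g => forall (l : list X) eps, eps > 0 ->
    exists h, K h /\ h <> g /\ pw_nbhd g l eps h.

Definition pw_separable {X : Type} (K : (X -> R) -> Prop) : Prop :=
  exists s : nat -> (X -> R), (forall n, K (s n)) /\
    forall g, K g -> pw_closure (fun h => exists n, h = s n) g.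

Definition rosenthal_compact {X : Type} (d : X -> X -> R) (K : (X -> R) -> Prop) : Prop :=
  (forall f, K f -> baire1 d f) /\ pw_compact K.

(** Every countable ordinal is the value of some [cord], and every [cord]
    denotes a countable ordinal; [OL s] denotes sup_n (s n). *)
Inductive cord : Type :=
| OZ : cord
| OS : cord -> cord
| OL : (nat -> cord) -> cord.

Definition sep_deriv {X : Type} (d : X -> X -> R) (f : X -> R) (a b : R)
  (F : X -> Prop) : X -> Prop :=
  fun x => mclosure d (fun y => F y /\ f y < a) x /\
           mclosure d (fun y => F y /\ f y > b) x.

Fixpoint sep_iter {X : Type} (d : X -> X -> R) (f : X -> R) (a b : R) (xi : cord)
  : X -> Prop :=
  match xi with
  | OZ => fun _ => True
  | OS o => sep_deriv d f a b (sep_iter d f a b o)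
  | OL s => fun x => forall n, sep_iter d f a b (s n) x
  end.

(** alpha(f) <= xi : for all rationals a < b, X^{(xi)}_{f,a,b} is empty
    (the derived sets decrease, so alpha(f,a,b) <= xi iff X^{(xi)} = empty). *)
Definition alpha_le {X : Type} (d : X -> X -> R) (f : X -> R) (xi : cord) : Prop :=
  forall a b : Q, (a < b)%Q -> forall x, ~ sep_iter d f (Q2R a) (Q2R b) xi x.

(* Main.v *)
Require Import Defs.
From Stdlib Require Import Reals QArith Qreals List.
From Stdlib Require Import Lra Lia Classical IndefiniteDescription FunctionalExtensionality Cantor.
Open Scope R_scope.

(** Fix [a < b]. If [x] lies in a high derived set of [g], one can grow around [x]
    a finite system of points at which [g < a] or [g > b], every point being
    approached by points of both kinds, while selecting functions [f n_0, f n_1, ...]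
    close enough to [g] to satisfy the same inequalities. Borel sets being
    projections of closed subsets of [N^N * X], the partial systems form a tree on
    [N], as in the proof of the Kunen-Martin theorem. An infinite branch would yield
    a countable set [P] and a subsequence of [(f n)] having a cluster point [g] for
    which [P \cap [g <= a]] and [P \cap [g >= b]] are both dense in [P], so that [g]
    would not be Baire-1. Hence the tree is well founded, and bar induction over its
    countably many nodes gives a countable ordinal bounding the ranks of all [g]
    simultaneously. In the first part the selected functions are kept pairwise
    distinct, which puts the cluster point in [Acc(K)]. *)

(** * Reciprocals of integers, metric closure and derived sets *)

Lemma inv_INR_S_pos (n : nat) : 0 < / INR (S n).
Proof. apply Rinv_0_lt_compat, lt_0_INR. lia. Qed.

Lemma inv_INR_S_le (n m : nat) : (n <= m)%nat -> / INR (S m) <= / INR (S n).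
Proof.
  intros H. apply Rinv_le_contravar.
  - apply lt_0_INR; lia.
  - apply le_INR; lia.
Qed.

Lemma inv_INR_S_small (eps : R) : eps > 0 -> exists n, / INR (S n) < eps.
Proof.
  intros H. destruct (archimed_cor1 eps H) as [N [H1 H2]].
  exists N. apply Rle_lt_trans with (/ INR N); [|exact H1].
  apply Rinv_le_contravar; [apply lt_0_INR; lia | apply le_INR; lia].
Qed.

Lemma mclosure_idem {X : Type} (d : X -> X -> R) (Hd : is_metric d) (A : X -> Prop) x :
  mclosure d (mclosure d A) x -> mclosure d A x.
Proof.
  destruct Hd as (_ & _ & _ & tri). intros H eps He.
  destruct (H (eps / 2)) as [y [Hy Hxy]]; [lra|].
  destruct (Hy (eps / 2)) as [z [Hz Hyz]]; [lra|].
  exists z. split; [exact Hz|]. specialize (tri x y z). lra.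
Qed.

Lemma mclosure_mono {X : Type} (d : X -> X -> R) (A B : X -> Prop) x :
  (forall y, A y -> B y) -> mclosure d A x -> mclosure d B x.
Proof.
  intros H HA eps He. destruct (HA eps He) as [y [Hy Hxy]]. exists y; auto.
Qed.

Lemma sep_iter_closed {X : Type} (d : X -> X -> R) (Hd : is_metric d) f a b xi :
  forall x, mclosure d (sep_iter d f a b xi) x -> sep_iter d f a b xi x.
Proof.
  induction xi as [|o IH|s IH]; simpl; intros x H.
  - exact I.
  - split; apply (mclosure_idem d Hd); revert H; apply mclosure_mono;
      intros y Hy; apply Hy.
  - intros n. apply IH. revert H. apply mclosure_mono. intros y Hy; apply Hy.
Qed.

(** The derivative of a set lies in its closure, and the iterates are closed. *)
Lemma sep_iter_succ {X : Type} (d : X -> X -> R) (Hd : is_metric d) f a b xi x :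
  sep_iter d f a b (OS xi) x -> sep_iter d f a b xi x.
Proof.
  intros [H _]. apply (sep_iter_closed d Hd). revert H. apply mclosure_mono. tauto.
Qed.

(** * Oscillation and Baire-1 functions *)

(** A set on which [g] takes values [<= a] and values [>= b] densely carries a
    nested sequence of balls along which the continuous approximations of [g]
    oscillate. *)
Lemma baire1_not_oscillating {X : Type} (d : X -> X -> R) (Hpolish : is_polish d)
  (g : X -> R) (a b : R) (P : X -> Prop) (x0 : X) :
  baire1 d g -> a < b -> P x0 ->
  (forall y, P y -> mclosure d (fun z => P z /\ g z <= a) y /\
                    mclosure d (fun z => P z /\ g z >= b) y) -> False.
Proof.
  intros [h [Hc Hl]] Hab HP0 HP.
  destruct Hpolish as [Hd [Hcomp _]].
  destruct Hd as (pos & dz & sym & tri).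
  (* With this [del], [a + 2 * del = b - 2 * del], so no value of [g] can lie below the former and
     above the latter. *)
  set (del := (b - a) / 4). assert (Hdel : del > 0) by (unfold del; lra).
  (* Move to a nearby point [y'] of [S], then shrink the ball until some late approximation [h i]
     stays within [del] of [g y'] on all of it. *)
  assert (half : forall S : X -> Prop,
    (forall y, P y -> mclosure d (fun z => P z /\ S z) y) ->
    forall y rho (t : nat), P y -> 0 < rho ->
    exists y' rho' i, P y' /\ S y' /\ 0 < rho' <= / INR (Datatypes.S t) /\
      (forall z, d y' z <= rho' -> d y z <= rho) /\ (i >= t)%nat /\
      forall z, d y' z <= rho' -> Rabs (h i z - g y') < del).
  { intros S HS y rho t Hy Hrho.
    destruct (HS y Hy (rho / 2)) as [y' [[HPy' HSy'] Hyy']]; [lra|].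
    destruct (Hl y' (del / 2)) as [N HN]; [lra|].
    set (i := Nat.max N t).
    destruct (Hc i y' (del / 2)) as [eta [Heta Hcont]]; [lra|].
    pose proof (inv_INR_S_pos t).
    set (rho' := Rmin (eta / 2) (Rmin (rho / 2) (/ INR (Datatypes.S t)))).
    assert (B1 : rho' <= eta / 2) by apply Rmin_l.
    assert (B2 : rho' <= rho / 2) by (eapply Rle_trans; [apply Rmin_r|apply Rmin_l]).
    assert (B3 : rho' <= / INR (Datatypes.S t)) by (eapply Rle_trans; [apply Rmin_r|apply Rmin_r]).
    assert (B4 : 0 < rho') by (unfold rho'; repeat apply Rmin_glb_lt; lra).
    exists y', rho', i. repeat split; auto.
    - intros z Hz. specialize (tri y y' z). lra.
    - unfold i; lia.
    - intros z Hz. specialize (Hcont z ltac:(lra)).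
      specialize (HN i ltac:(unfold i; lia)). unfold Rdist in HN.
      replace (h i z - g y') with ((h i z - h i y') + (h i y' - g y')) by ring.
      eapply Rle_lt_trans; [apply Rabs_triang|lra]. }
  assert (step : forall ts : nat * (X * R), exists s' : X * R,
    P (fst (snd ts)) -> 0 < snd (snd ts) ->
    P (fst s') /\ 0 < snd s' <= / INR (S (fst ts)) /\
    (forall z, d (fst s') z <= snd s' -> d (fst (snd ts)) z <= snd (snd ts)) /\
    exists i j, (i >= fst ts)%nat /\ (j >= fst ts)%nat /\
      forall z, d (fst s') z <= snd s' -> h i z < a + del /\ h j z > b - del).
  { intros [t [y rho]]; simpl.
    destruct (classic (P y /\ 0 < rho)) as [[Hy Hr]|Hn].
    2: { exists (y, rho). intros; exfalso; tauto. }
    destruct (half (fun z => g z <= a) (fun y Hy => proj1 (HP y Hy)) y rho t Hy Hr)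
      as (y1 & r1 & i & Hy1 & Hg1 & Hr1 & Hb1 & Hi & Hv1).
    destruct (half (fun z => g z >= b) (fun y Hy => proj2 (HP y Hy)) y1 r1 t Hy1 (proj1 Hr1))
      as (y2 & r2 & j & Hy2 & Hg2 & Hr2 & Hb2 & Hj & Hv2).
    exists (y2, r2). intros _ _; simpl. repeat split; try tauto; auto.
    exists i, j. repeat split; auto.
    - specialize (Hv1 z (Hb2 z H)). apply Rabs_def2 in Hv1. lra.
    - specialize (Hv2 z H). apply Rabs_def2 in Hv2. lra. }
  destruct (functional_choice _ step) as [F HF].
  set (s := fix s (t : nat) : X * R :=
     match t with O => (x0, 1) | Datatypes.S t => F (t, s t) end).
  assert (inv : forall t, P (fst (s t)) /\ 0 < snd (s t)).
  { induction t as [|t [I1 I2]]; simpl.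
    - split; [exact HP0|lra].
    - destruct (HF (t, s t) I1 I2) as (Q1 & Q2 & _). split; [exact Q1|apply Q2]. }
  assert (nest : forall t k z, d (fst (s (k + t)%nat)) z <= snd (s (k + t)%nat) ->
      d (fst (s t)) z <= snd (s t)).
  { intros t k; induction k as [|k IHk]; intros z Hz; [exact Hz|].
    apply IHk. destruct (inv (k + t)%nat) as [I1 I2].
    destruct (HF (k + t, s (k + t))%nat I1 I2) as (_ & _ & Q & _). apply Q. exact Hz. }
  assert (cen : forall t k, d (fst (s t)) (fst (s (k + t)%nat)) <= snd (s t)).
  { intros t k. apply (nest t k). rewrite (proj2 (dz _ _) eq_refl).
    left. apply inv. }
  destruct (Hcomp (fun t => fst (s t))) as [z Hz].
  { intros eps He. destruct (inv_INR_S_small (eps / 2)) as [N HN]; [lra|].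
    exists (Datatypes.S N). intros n m Hn Hm.
    assert (HR : snd (s (Datatypes.S N)) < eps / 2).
    { destruct (inv N) as [I1 I2]. destruct (HF (N, s N) I1 I2) as (_ & Q & _).
      simpl in *. lra. }
    pose proof (cen (Datatypes.S N) (n - Datatypes.S N)%nat) as C1.
    pose proof (cen (Datatypes.S N) (m - Datatypes.S N)%nat) as C2.
    replace (n - Datatypes.S N + Datatypes.S N)%nat with n in C1 by lia.
    replace (m - Datatypes.S N + Datatypes.S N)%nat with m in C2 by lia.
    pose proof (tri (fst (s n)) (fst (s (Datatypes.S N))) (fst (s m))).
    rewrite (sym (fst (s n)) (fst (s (Datatypes.S N)))) in H. lra. }
  assert (Hin : forall t, d (fst (s t)) z <= snd (s t)).
  { intros t. apply Rnot_lt_le. intros Hlt.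
    destruct (Hz (d (fst (s t)) z - snd (s t))) as [N HN]; [lra|].
    specialize (HN (N + t)%nat ltac:(lia)).
    pose proof (cen t N). pose proof (tri (fst (s t)) (fst (s (N + t)%nat)) z). lra. }
  (* [z] lies in every ball, so arbitrarily late approximations at [z] are below [a + del] and
     others above [b - del], against their convergence. *)
  destruct (Hl z del Hdel) as [N HN].
  destruct (inv N) as [I1 I2].
  destruct (HF (N, s N) I1 I2) as (_ & _ & _ & i & j & Hi & Hj & Hv).
  destruct (Hv z (Hin (Datatypes.S N))) as [V1 V2].
  pose proof (HN i Hi) as A1. pose proof (HN j Hj) as A2.
  unfold Rdist in A1, A2. apply Rabs_def2 in A1. apply Rabs_def2 in A2.
  unfold del in *. lra.
Qed.

(** * Borel sets as projections of closed sets of codes *)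

Definition nat_conv (u : nat -> nat -> nat) (w : nat -> nat) : Prop :=
  forall i, exists N, forall j, (j >= N)%nat -> u j i = w i.

(** [E] is a closed subset of [N^N * X] projecting onto [X], on which the
    pullback of each [Q n] is clopen. *)
Definition resolves {X : Type} (d : X -> X -> R) (E : (nat -> nat) -> X -> Prop)
  (Q : nat -> X -> Prop) : Prop :=
  (forall x, exists w, E w x) /\
  forall u w v x, nat_conv u w -> seq_converges d v x -> (forall j, E (u j) (v j)) ->
    E w x /\ forall n, exists N, forall j, (j >= N)%nat -> (Q n (v j) <-> Q n x).

(** The pairing bijection splits [w] into rows; row [n] serves as a code for [Q n], and the row
    conditions are intersected. *)
Lemma resolves_family {X : Type} (d : X -> X -> R) (Q : nat -> X -> Prop) :
  (forall n, exists E, resolves d E (fun _ => Q n)) -> exists E, resolves d E Q.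
Proof.
  intros H. destruct (functional_choice _ H) as [E HE].
  exists (fun w x => forall n, E n (fun i => w (to_nat (n, i))) x). split.
  - intros x.
    destruct (functional_choice _ (fun n => proj1 (HE n) x)) as [w Hw].
    exists (fun t => w (fst (of_nat t)) (snd (of_nat t))).
    intros n. specialize (Hw n).
    replace (fun i => _) with (w n); [exact Hw|].
    apply functional_extensionality.
    intros i. rewrite cancel_of_to. reflexivity.
  - intros u w v x Hu Hv Hj.
    assert (A : forall n, E n (fun i => w (to_nat (n, i))) x /\
       exists N, forall j, (j >= N)%nat -> (Q n (v j) <-> Q n x)).
    { intros n.
      destruct (proj2 (HE n) (fun j i => u j (to_nat (n, i)))
        (fun i => w (to_nat (n, i))) v x) as [A1 A2].
      - intros i. apply Hu.
      - exact Hv.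
      - intros j. apply Hj.
      - split; [exact A1|apply (A2 O)]. }
    split; intros n; apply A.
Qed.

(** Induction on the Borel construction: the code records enough to make membership in [A] locally
    constant on [E], and a complement keeps the same [E]. *)
Lemma borel_resolvable {X : Type} (d : X -> X -> R) (Hd : is_metric d) (A : X -> Prop) :
  borel d A -> exists E, resolves d E (fun _ => A).
Proof.
  destruct Hd as (pos & dz & sym & tri).
  induction 1 as [A HA|A _ [E HE]|A _ IH|A B _ [E HE] HAB].
  (* Digit [0] says that [x] is outside [A], digit [S k] that the ball of radius [/ INR (S k)]
     around [x] lies in [A]; both conditions are closed. *)
  - exists (fun w x => match w O with
       | O => ~ A x
       | S k => forall y, d x y < / INR (S k) -> A y end).
    split.
    + intros x. destruct (classic (A x)) as [Hx|Hx].
      * destruct (HA x Hx) as [eps [He Hb]].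
        destruct (inv_INR_S_small eps He) as [k Hk].
        exists (fun _ => S k). intros y Hy. apply Hb. lra.
      * exists (fun _ => O). exact Hx.
    + intros u w v x Hu Hv Hj. destruct (Hu O) as [N HN].
      assert (HN' : forall j, (j >= N)%nat -> match w O with
         | O => ~ A (v j)
         | S k => forall y, d (v j) y < / INR (S k) -> A y end).
      { intros j Hge. rewrite <- (HN j Hge). apply Hj. }
      destruct (w O) as [|k].
      * assert (Hx : ~ A x).
        { intros Hx. destruct (HA x Hx) as [eps [He Hb]].
          destruct (Hv eps He) as [M HM].
          apply (HN' (N + M)%nat); [lia|]. apply Hb. rewrite sym. apply HM. lia. }
        split; [exact Hx|]. intros _. exists N. intros j Hge.
        specialize (HN' j Hge). tauto.
      * assert (Hx : forall y, d x y < / INR (S k) -> A y).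
        { intros y Hy. destruct (Hv (/ INR (S k) - d x y)) as [M HM]; [lra|].
          apply (HN' (N + M)%nat); [lia|]. specialize (HM (N + M)%nat ltac:(lia)).
          specialize (tri (v (N + M)%nat) x y). lra. }
        assert (self : forall y, d y y < / INR (S k)).
        { intros y. rewrite (proj2 (dz y y) eq_refl). apply inv_INR_S_pos. }
        split; [exact Hx|]. intros _. exists N. intros j Hge.
        specialize (HN' j Hge). split; intros _; auto.
  - exists E. destruct HE as [H1 H2]. split; [exact H1|].
    intros u w v x Hu Hv Hj. destruct (H2 u w v x Hu Hv Hj) as [E1 E2].
    split; [exact E1|]. intros n. destruct (E2 n) as [N HN]. exists N.
    intros j Hge. rewrite (HN j Hge). tauto.
  - destruct (resolves_family d A IH) as [E [H1 H2]].
    (* A first digit [S n] names a member of the union containing [x], and [0] denies that there is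
       one; the tail codes all the [A n] at once. *)
    exists (fun w x => E (fun i => w (S i)) x /\
      match w O with O => forall n, ~ A n x | S n => A n x end).
    split.
    + intros x. destruct (H1 x) as [w Hw].
      destruct (classic (exists n, A n x)) as [[n Hn]|Hn].
      * exists (fun t => match t with O => S n | S i => w i end). split; assumption.
      * exists (fun t => match t with O => O | S i => w i end).
        split; [assumption|]. intros n H. apply Hn. exists n; exact H.
    + intros u w v x Hu Hv Hj.
      destruct (H2 (fun j i => u j (S i)) (fun i => w (S i)) v x) as [E1 E2];
        [intros i; apply Hu|exact Hv|intros j; apply Hj|].
      destruct (Hu O) as [N HN].
      assert (HN' : forall j, (j >= N)%nat ->
         match w O with O => forall n, ~ A n (v j) | S n => A n (v j) end).
      { intros j Hge. rewrite <- (HN j Hge). apply Hj. }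
      destruct (w O) as [|n].
      * assert (Hx : forall n, ~ A n x).
        { intros n. destruct (E2 n) as [M HM].
          rewrite <- (HM (N + M)%nat) by lia. apply HN'. lia. }
        split; [split; assumption|]. intros _. exists N. intros j Hge.
        specialize (HN' j Hge). split; intros [n Hn]; exfalso; [exact (HN' n Hn)|exact (Hx n Hn)].
      * assert (Hx : A n x).
        { destruct (E2 n) as [M HM].
          rewrite <- (HM (N + M)%nat) by lia. apply HN'. lia. }
        split; [split; assumption|]. intros _. exists N. intros j Hge.
        specialize (HN' j Hge). split; intros _; exists n; assumption.
  - exists E. destruct HE as [H1 H2]. split; [exact H1|].
    intros u w v x Hu Hv Hj. destruct (H2 u w v x Hu Hv Hj) as [E1 E2].
    split; [exact E1|]. intros n. destruct (E2 n) as [N HN]. exists N.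
    intros j Hge. rewrite <- !HAB. apply HN. exact Hge.
Qed.

(** Row [0] of a code lists ever closer approximations to the point from the dense sequence, so
    convergence of the codes alone makes the points Cauchy; row [1] resolves the sets [Q n]. *)
Lemma polish_coding {X : Type} (d : X -> X -> R) (Hpolish : is_polish d)
  (Q : nat -> X -> Prop) :
  (forall n, borel d (Q n)) ->
  exists E : (nat -> nat) -> X -> Prop,
    (forall x, exists w, E w x) /\
    forall u w v, nat_conv u w -> (forall j, E (u j) (v j)) ->
      exists x, seq_converges d v x /\
        forall n, exists N, forall j, (j >= N)%nat -> (Q n (v j) <-> Q n x).
Proof.
  intros HQ. destruct Hpolish as [Hd [Hcomp [s Hs]]].
  destruct (resolves_family d Q (fun n => borel_resolvable d Hd (Q n) (HQ n)))
    as [E [H1 H2]].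
  destruct Hd as (pos & dz & sym & tri).
  exists (fun w x => (forall k, d x (s (w (to_nat (0%nat, k)))) < / INR (S k)) /\
    E (fun i => w (to_nat (1%nat, i))) x).
  split.
  - intros x. destruct (H1 x) as [w Hw].
    assert (A : forall k, exists n, d x (s n) < / INR (S k)).
    { intros k. destruct (Hs x (/ INR (S k)) (inv_INR_S_pos k)) as [y [[n ->] Hy]].
      exists n; exact Hy. }
    destruct (functional_choice _ A) as [c Hc].
    exists (fun t => match of_nat t with (O, k) => c k | (S _, i) => w i end).
    split.
    + intros k. rewrite cancel_of_to. apply Hc.
    + replace (fun i => _) with w; [exact Hw|].
      apply functional_extensionality.
      intros i. rewrite cancel_of_to. reflexivity.
  - intros u w v Hu Hj.
    destruct (Hcomp v) as [x Hx].
    { intros eps He. destruct (inv_INR_S_small (eps / 2)) as [k Hk]; [lra|].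
      destruct (Hu (to_nat (0%nat, k))) as [N HN]. exists N. intros n m Hn Hm.
      pose proof (proj1 (Hj n) k) as A1. pose proof (proj1 (Hj m) k) as A2.
      rewrite HN in A1, A2 by assumption.
      set (q := s (w (to_nat (0%nat, k)))) in *.
      specialize (tri (v n) q (v m)). rewrite (sym q (v m)) in tri. lra. }
    exists x. split; [exact Hx|].
    apply (H2 (fun j i => u j (to_nat (1%nat, i))) (fun i => w (to_nat (1%nat, i))));
      [intros i; apply Hu|exact Hx|intros j; apply Hj].
Qed.

(** * The tree of partial systems *)

(** A branch [v] encodes both the sequence of selected indices and, for every
    [m], a code of the [m]-th point. *)
Definition index (v : nat -> nat) (j : nat) : nat := v (to_nat (0%nat, j)).
Definition code (v : nat -> nat) (m i : nat) : nat := v (to_nat (S m, i)).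

(** Bookkeeping: every index is a value infinitely often, and [target k <= k], so the point treated
    at stage [k] is already present. *)
Definition target (k : nat) : nat := fst (of_nat k).

Lemma to_nat_bound (p q : nat) : (p + q <= to_nat (p, q))%nat.
Proof. pose proof (to_nat_non_decreasing p q). lia. Qed.

Lemma target_le (k : nat) : (target k <= k)%nat.
Proof.
  unfold target. rewrite <- (cancel_to_of k) at 2.
  destruct (of_nat k) as [p q]. pose proof (to_nat_bound p q). cbn [fst]. lia.
Qed.

Lemma target_recurrent (m N : nat) : exists k, (k >= N)%nat /\ target k = m.
Proof.
  exists (to_nat (m, N)). unfold target. rewrite cancel_of_to.
  pose proof (to_nat_bound m N). split; [lia|reflexivity].
Qed.

(** Stage [j] adds near the point [x (target j)] a point [x (2j+1)], where the
    selected functions are to be [< a], and a point [x (2j+2)], where they are to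
    be [> b], and then selects the function [f (index v j)]. *)
Definition scheme {X : Type} (d : X -> X -> R) (E : (nat -> nat) -> X -> Prop)
  (f : nat -> X -> R) (a b : R) (T : nat -> nat -> Prop) (k : nat)
  (v : nat -> nat) (x : nat -> X) : Prop :=
  (forall m, E (code v m) (x m)) /\
  (forall j, (j < k)%nat ->
     d (x (target j)) (x (2 * j + 1)%nat) < / INR (S j) /\
     d (x (target j)) (x (2 * j + 2)%nat) < / INR (S j)) /\
  (forall i j, (i < j < k)%nat -> T (index v i) (index v j)) /\
  (forall m j, (m <= j < k)%nat ->
     f (index v j) (x (2 * m + 1)%nat) < a /\ f (index v j) (x (2 * m + 2)%nat) > b).

Definition agree (k : nat) (u v : nat -> nat) : Prop :=
  forall i, (i < k)%nat -> v i = u i.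

(** [g] guides the construction: the points [x 0, ..., x (2 * k)] in use stay in its [xi]-th derived
    set. Later points are padding. *)
Definition realizes {X : Type} (d : X -> X -> R) (E : (nat -> nat) -> X -> Prop)
  (f : nat -> X -> R) (a b : R) (T : nat -> nat -> Prop) (xi : cord) (k : nat)
  (g : X -> R) (v : nat -> nat) (x : nat -> X) : Prop :=
  scheme d E f a b T k v x /\
  (forall m, (m <= 2 * k)%nat -> sep_iter d g a b xi (x m)) /\
  (forall m, (m < k)%nat -> g (x (2 * m + 1)%nat) < a /\ g (x (2 * m + 2)%nat) > b).

(** The node is the first [k] digits of [u]. One [xi] serves for all [g] in [G], so at the root it
    is the uniform bound sought. *)
Definition blocked {X : Type} (d : X -> X -> R) (E : (nat -> nat) -> X -> Prop)
  (f : nat -> X -> R) (a b : R) (T : nat -> nat -> Prop) (G : (X -> R) -> Prop)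
  (k : nat) (u : nat -> nat) : Prop :=
  exists xi, forall g v x, G g -> agree k u v -> ~ realizes d E f a b T xi k g v x.

Definition upd (u : nat -> nat) (k c : nat) : nat -> nat :=
  fun i => if Nat.eqb i k then c else u i.

(** [n] lists the indices already selected below stage [k]; [T] is the relation required between an
    earlier and a later selection. *)
Definition approximable {X : Type} (f : nat -> X -> R) (T : nat -> nat -> Prop)
  (G : (X -> R) -> Prop) : Prop :=
  forall g, G g -> forall (n : nat -> nat) (k : nat) (l : list X) eps, eps > 0 ->
    exists p, (forall i, (i < k)%nat -> T (n i) p) /\ pw_nbhd g l eps (f p).

Lemma strict_margin {X : Type} (g : X -> R) (a b : R) (l : list X) :
  exists eps, eps > 0 /\ forall h, pw_nbhd g l eps h ->
    forall y, In y l -> (g y < a -> h y < a) /\ (g y > b -> h y > b).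
Proof.
  induction l as [|y l [eps [He H]]].
  - exists 1. split; [lra|]. intros h _ y [].
  - assert (exists e, e > 0 /\ (g y < a -> e <= a - g y) /\ (g y > b -> e <= g y - b))
      as (e & He' & H1 & H2).
    { destruct (Rlt_le_dec (g y) a) as [A|A]; destruct (Rlt_le_dec b (g y)) as [B|B].
      - exists (Rmin (a - g y) (g y - b)). split; [apply Rmin_glb_lt; lra|].
        split; intros _; [apply Rmin_l|apply Rmin_r].
      - exists (a - g y). repeat split; intros; lra.
      - exists (g y - b). repeat split; intros; lra.
      - exists 1. repeat split; intros; lra. }
    exists (Rmin e eps). split; [apply Rmin_glb_lt; lra|].
    pose proof (Rmin_l e eps). pose proof (Rmin_r e eps).
    intros h Hh z [<-|Hz].
    + specialize (Hh y (or_introl eq_refl)). apply Rabs_def2 in Hh.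
      split; intros A; [specialize (H1 A)|specialize (H2 A)]; lra.
    + apply H; [|exact Hz]. intros t Ht. specialize (Hh t (or_intror Ht)). lra.
Qed.

(** If the children are blocked by the ordinals [xi c], then [sup xi + 1] blocks the
    node: the last derivation step provides the two points of the next stage. *)
Lemma blocked_of_children {X : Type} (d : X -> X -> R) (Hd : is_metric d) E f a b T G k u :
  (forall x : X, exists w, E w x) -> approximable f T G ->
  (forall c, blocked d E f a b T G (S k) (upd u k c)) ->
  blocked d E f a b T G k u.
Proof.
  intros HE HG Hc. destruct (functional_choice _ Hc) as [xi Hxi].
  exists (OS (OL xi)). intros g v x Hg Hag [[S1 [S2 [S3 S4]]] [R1 R2]].
  pose proof (target_le k) as Htk.
  (* The treated point lies in the derivative of the [OL xi] set, hence is approached by points of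
     that set of both kinds. *)
  destruct (R1 (target k)) as [D1 D2]; [lia|].
  destruct (D1 (/ INR (S k)) (inv_INR_S_pos k)) as [y1 [[Y1 Y1a] Yd1]].
  destruct (D2 (/ INR (S k)) (inv_INR_S_pos k)) as [y2 [[Y2 Y2b] Yd2]].
  destruct (HE y1) as [w1 Hw1]. destruct (HE y2) as [w2 Hw2].
  set (x' := fun m => if Nat.eqb m (2 * k + 1) then y1
                      else if Nat.eqb m (2 * k + 2) then y2 else x m).
  assert (X1 : x' (2 * k + 1)%nat = y1) by (unfold x'; rewrite Nat.eqb_refl; reflexivity).
  assert (X2 : x' (2 * k + 2)%nat = y2).
  { unfold x'. rewrite Nat.eqb_refl.
    destruct (Nat.eqb_spec (2 * k + 2) (2 * k + 1)); [lia|reflexivity]. }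
  assert (X3 : forall m, (m <= 2 * k)%nat -> x' m = x m).
  { intros m Hm. unfold x'.
    destruct (Nat.eqb_spec m (2 * k + 1)); [lia|].
    destruct (Nat.eqb_spec m (2 * k + 2)); [lia|reflexivity]. }
  (* A function close enough to [g] at the finitely many old and new points inherits all strict
     inequalities of [g] there. *)
  destruct (strict_margin g a b (map x' (seq 0 (2 * k + 3)))) as [eps [He Hm]].
  destruct (HG g Hg (index v) k (map x' (seq 0 (2 * k + 3))) eps He) as [p [Hp Hn]].
  assert (Hfp : forall m, (m <= 2 * k + 2)%nat ->
     (g (x' m) < a -> f p (x' m) < a) /\ (g (x' m) > b -> f p (x' m) > b)).
  { intros m Hle. apply (Hm _ Hn). apply in_map, in_seq. lia. }
  set (v' := fun t => match of_nat t with
     | (O, q) => if Nat.eqb q k then p else v t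
     | (S m, q) => if Nat.eqb m (2 * k + 1) then w1 q
                   else if Nat.eqb m (2 * k + 2) then w2 q else v t end).
  assert (V1 : index v' k = p).
  { unfold index, v'. rewrite cancel_of_to, Nat.eqb_refl. reflexivity. }
  assert (V2 : forall j, (j < k)%nat -> index v' j = index v j).
  { intros j Hj. unfold index, v'. rewrite cancel_of_to.
    destruct (Nat.eqb_spec j k); [lia|reflexivity]. }
  assert (V3 : forall m, E (code v' m) (x' m)).
  { intros m. unfold x', v', code. specialize (S1 m). unfold code in S1.
    destruct (Nat.eqb_spec m (2 * k + 1)) as [e1|n1];
      [|destruct (Nat.eqb_spec m (2 * k + 2)) as [e2|n2]].
    - replace (fun i => _) with w1; [exact Hw1|].
      apply functional_extensionality. intros i.
      rewrite cancel_of_to, (proj2 (Nat.eqb_eq _ _) e1). reflexivity.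
    - replace (fun i => _) with w2; [exact Hw2|].
      apply functional_extensionality. intros i.
      rewrite cancel_of_to, (proj2 (Nat.eqb_neq _ _) n1), (proj2 (Nat.eqb_eq _ _) e2).
      reflexivity.
    - match type of S1 with E ?w _ => replace (fun i => _) with w; [exact S1|] end.
      apply functional_extensionality. intros i.
      rewrite cancel_of_to, (proj2 (Nat.eqb_neq _ _) n1), (proj2 (Nat.eqb_neq _ _) n2).
      reflexivity. }
  (* [v'] differs from [v] only at positions at least [k], because [to_nat (p, q) >= p + q]; so it
     still extends the node. *)
  assert (V4 : agree k u v').
  { intros t Ht. rewrite <- (Hag t Ht). unfold v'.
    pose proof (cancel_to_of t) as Et. destruct (of_nat t) as [m q].
    pose proof (to_nat_bound m q). destruct m as [|m].
    - destruct (Nat.eqb_spec q k); [lia|reflexivity].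
    - destruct (Nat.eqb_spec m (2 * k + 1)); [lia|].
      destruct (Nat.eqb_spec m (2 * k + 2)); [lia|reflexivity]. }
  assert (G' : forall m, (m < S k)%nat ->
     g (x' (2 * m + 1)%nat) < a /\ g (x' (2 * m + 2)%nat) > b).
  { intros m Hlt. destruct (Nat.eq_dec m k) as [->|Hne].
    - rewrite X1, X2. split; assumption.
    - rewrite !X3 by lia. apply R2. lia. }
  (* The digit [v' k] decides which child is reached; points of the [OL xi] set lie in the derived
     set of that child's ordinal. *)
  apply (Hxi (v' k) g v' x' Hg).
  { intros t Ht. unfold upd. destruct (Nat.eqb_spec t k) as [->|Hne]; [reflexivity|].
    apply V4. lia. }
  split; [|split; [|exact G']].
  - split; [exact V3|]. split; [|split].
    + intros j Hj. destruct (Nat.eq_dec j k) as [->|Hne].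
      * rewrite X1, X2, X3 by lia. split; assumption.
      * pose proof (target_le j). rewrite !X3 by lia. apply S2. lia.
    + intros i j Hij. rewrite (V2 i) by lia.
      destruct (Nat.eq_dec j k) as [->|Hne].
      * rewrite V1. apply Hp. lia.
      * rewrite V2 by lia. apply S3. lia.
    + intros m j Hmj. destruct (Nat.eq_dec j k) as [->|Hne].
      * rewrite V1. destruct (G' m ltac:(lia)). split; apply Hfp; (lia || assumption).
      * rewrite V2, !X3 by lia. apply S4. lia.
  - intros m Hm2. destruct (Nat.eq_dec m (2 * k + 1)) as [->|N1]; [rewrite X1; apply Y1|].
    destruct (Nat.eq_dec m (2 * k + 2)) as [->|N2]; [rewrite X2; apply Y2|].
    rewrite X3 by lia. exact (sep_iter_succ d Hd _ _ _ _ _ (R1 m ltac:(lia)) _).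
Qed.

(** Bar induction in contrapositive form: an unblocked node has an unblocked child, and choice
    follows these children along an infinite branch. *)
Lemma unblocked_branch {X : Type} (d : X -> X -> R) (Hd : is_metric d) E f a b T G :
  (forall x : X, exists w, E w x) -> approximable f T G ->
  ~ blocked d E f a b T G 0 (fun _ => 0%nat) ->
  exists u, forall k, exists v x, agree k u v /\ scheme d E f a b T k v x.
Proof.
  intros HE HG H0.
  assert (step : forall ku : nat * (nat -> nat), exists c,
     ~ blocked d E f a b T G (fst ku) (snd ku) ->
     ~ blocked d E f a b T G (S (fst ku)) (upd (snd ku) (fst ku) c)).
  { intros [k u]; simpl. apply NNPP. intros Hn. pose proof (not_ex_all_not _ _ Hn) as Hall. cbv beta in Hall.
    assert (Hb : ~ blocked d E f a b T G k u).
    { intros Hb. apply (Hall O). tauto. }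
    apply Hb. apply blocked_of_children; auto.
    intros c. apply NNPP. intros Hc. apply (Hall c). auto. }
  destruct (functional_choice _ step) as [c Hc].
  set (s := fix s k := match k with O => fun _ : nat => 0%nat
     | Datatypes.S k => upd (s k) k (c (k, s k)) end).
  assert (Hs : forall k, ~ blocked d E f a b T G k (s k)).
  { induction k as [|k IH]; [exact H0|]. exact (Hc (k, s k) IH). }
  assert (Hst : forall i k, s (k + S i)%nat i = s (S i) i).
  { intros i k. induction k as [|k IH]; [reflexivity|].
    rewrite <- IH. simpl. unfold upd at 1.
    destruct (Nat.eqb_spec i (k + S i)); [lia|reflexivity]. }
  exists (fun i => s (S i) i). intros k. specialize (Hs k).
  (* At [OZ] the derived set is the whole space; only the scheme is kept from the realization. *)
  apply NNPP. intros Hn. apply Hs. exists OZ. intros g v x Hg Hag Hr.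
  apply Hn. exists v, x. split; [|apply Hr].
  intros i Hi. rewrite (Hag i Hi). rewrite <- (Hst i (k - S i)%nat).
  f_equal. f_equal. lia.
Qed.

(** * Cluster functions and the limit along a branch *)

Definition cluster {X : Type} (h : nat -> X -> R) (g : X -> R) : Prop :=
  forall (l : list X) eps N, eps > 0 -> exists n, (n >= N)%nat /\ pw_nbhd g l eps (h n).

Lemma cluster_le {X : Type} (h : nat -> X -> R) g x c N :
  cluster h g -> (forall n, (n >= N)%nat -> h n x <= c) -> g x <= c.
Proof.
  intros Hcl H. apply Rnot_lt_le. intros Hlt.
  destruct (Hcl (x :: nil) (g x - c) N) as [n [Hn Hb]]; [lra|].
  specialize (Hb x (or_introl eq_refl)). apply Rabs_def2 in Hb.
  specialize (H n Hn). lra.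
Qed.

Lemma cluster_ge {X : Type} (h : nat -> X -> R) g x c N :
  cluster h g -> (forall n, (n >= N)%nat -> h n x >= c) -> g x >= c.
Proof.
  intros Hcl H. apply Rnot_lt_ge. intros Hlt.
  destruct (Hcl (x :: nil) (c - g x) N) as [n [Hn Hb]]; [lra|].
  specialize (Hb x (or_introl eq_refl)). apply Rabs_def2 in Hb.
  specialize (H n Hn). lra.
Qed.

Lemma dist_limit_le {X : Type} (d : X -> X -> R) (Hd : is_metric d) u v x y c N :
  seq_converges d u x -> seq_converges d v y ->
  (forall n, (n >= N)%nat -> d (u n) (v n) <= c) -> d x y <= c.
Proof.
  destruct Hd as (pos & dz & sym & tri). intros Hu Hv H.
  apply Rnot_lt_le. intros Hlt.
  destruct (Hu ((d x y - c) / 2)) as [N1 H1]; [lra|].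
  destruct (Hv ((d x y - c) / 2)) as [N2 H2]; [lra|].
  set (n := (N + N1 + N2)%nat).
  specialize (H n ltac:(lia)). specialize (H1 n ltac:(lia)). specialize (H2 n ltac:(lia)).
  pose proof (tri x (u n) y). pose proof (tri (u n) (v n) y).
  rewrite (sym x (u n)) in *. lra.
Qed.

Lemma uniform_rank_bound_at {X : Type} (d : X -> X -> R) (Hpolish : is_polish d)
  (f : nat -> X -> R) (T : nat -> nat -> Prop) (G : (X -> R) -> Prop) (a b : R) :
  a < b ->
  (forall n, borel d (fun x => f n x < a)) ->
  (forall n, borel d (fun x => f n x > b)) ->
  approximable f T G ->
  (forall n : nat -> nat, (forall i j, (i < j)%nat -> T (n i) (n j)) ->
     exists g, baire1 d g /\ cluster (fun j => f (n j)) g) ->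
  exists xi, forall g, G g -> forall x, ~ sep_iter d g a b xi x.
Proof.
  intros Hab Ba Bb HG Hcl. pose proof (proj1 Hpolish) as Hd.
  destruct (polish_coding d Hpolish (fun t => match of_nat t with
     | (O, n) => fun x => f n x < a | (S _, n) => fun x => f n x > b end))
    as [E [HE Hlim]].
  { intros t. destruct (of_nat t) as [[|m] n]; [apply Ba|apply Bb]. }
  destruct (classic (blocked d E f a b T G 0 (fun _ => 0%nat))) as [[xi Hxi]|Hb].
  (* At stage [0] only the codes and [x 0] are constrained, so a point of the [xi]-th derived set,
     repeated with one code, would realize the root. *)
  { exists xi. intros g Hg x Hx. destruct (HE x) as [w Hw].
    apply (Hxi g (fun t => match of_nat t with (O, _) => 0%nat | (S _, i) => w i end)
      (fun _ => x) Hg); [intros i Hi; lia|].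
    split; [|split; [intros; exact Hx|intros; lia]].
    split; [|split; [intros; lia|split; intros; lia]].
    intros m. replace (code _ m) with w; [exact Hw|].
    apply functional_extensionality. intros i.
    unfold code. rewrite cancel_of_to. reflexivity. }
  exfalso. destruct (unblocked_branch d Hd E f a b T G HE HG Hb) as [u Hu].
  destruct (functional_choice _ Hu) as [v Hv]. destruct (functional_choice _ Hv) as [x Hx].
  clear Hu Hv Hb.
  (* The [v k] agree with [u] on ever longer prefixes, so for each fixed [m] the codes of the [m]-th
     points converge, and with them the points. *)
  assert (conv : forall m, exists y, seq_converges d (fun k => x k m) y /\
     forall t, exists N, forall j, (j >= N)%nat ->
       ((match of_nat t with
        | (O, n) => fun x => f n x < a | (S _, n) => fun x => f n x > b end) (x j m) <->
        (match of_nat t with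
        | (O, n) => fun x => f n x < a | (S _, n) => fun x => f n x > b end) y)).
  { intros m. apply (Hlim (fun k => code (v k) m) (code u m)).
    - intros i. exists (S (to_nat (S m, i))). intros j Hj.
      unfold code. apply (proj1 (Hx j)). lia.
    - intros j. apply (Hx j). }
  destruct (functional_choice _ conv) as [y Hy].
  assert (idx : forall j k, (k > to_nat (0%nat, j))%nat -> index (v k) j = index u j).
  { intros j k Hk. apply (proj1 (Hx k)). exact Hk. }
  assert (Yd : forall j, d (y (target j)) (y (2 * j + 1)%nat) <= / INR (S j) /\
                         d (y (target j)) (y (2 * j + 2)%nat) <= / INR (S j)).
  { intros j. split.
    - apply (dist_limit_le d Hd _ _ _ _ _ (S j) (proj1 (Hy _)) (proj1 (Hy _))).
      intros k Hk. left. apply (Hx k). lia.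
    - apply (dist_limit_le d Hd _ _ _ _ _ (S j) (proj1 (Hy _)) (proj1 (Hy _))).
      intros k Hk. left. apply (Hx k). lia. }
  (* The strict inequalities survive the limit although the functions are only Borel: the coding
     makes membership in these sets eventually constant. *)
  assert (Yf : forall m j, (m <= j)%nat ->
     f (index u j) (y (2 * m + 1)%nat) < a /\ f (index u j) (y (2 * m + 2)%nat) > b).
  { intros m j Hmj. split.
    - destruct (proj2 (Hy (2 * m + 1)%nat) (to_nat (0%nat, index u j))) as [N HN].
      set (k := (N + S j + S (to_nat (0%nat, j)))%nat).
      specialize (HN k ltac:(lia)). rewrite cancel_of_to in HN. apply HN.
      rewrite <- (idx j k) by lia. apply (Hx k). lia.
    - destruct (proj2 (Hy (2 * m + 2)%nat) (to_nat (1%nat, index u j))) as [N HN].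
      set (k := (N + S j + S (to_nat (0%nat, j)))%nat).
      specialize (HN k ltac:(lia)). rewrite cancel_of_to in HN. apply HN.
      rewrite <- (idx j k) by lia. apply (Hx k). lia. }
  destruct (Hcl (index u)) as [g [Hg1 Hgc]].
  { intros i j Hij.
    set (k := (S j + S (to_nat (0%nat, i)) + S (to_nat (0%nat, j)))%nat).
    rewrite <- (idx i k), <- (idx j k) by lia. apply (Hx k). lia. }
  (* On the limit points, [g <= a] at odd indices and [g >= b] at positive even ones; since [target]
     recurs, each point is approached by both kinds. *)
  apply (baire1_not_oscillating d Hpolish g a b (fun z => exists m, z = y m) (y O) Hg1 Hab).
  { exists O; reflexivity. }
  intros z [m ->]. split; intros eps He;
    destruct (inv_INR_S_small eps He) as [N HN];
    destruct (target_recurrent m N) as [k [Hk <-]];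
    pose proof (inv_INR_S_le N k Hk); destruct (Yd k).
  - exists (y (2 * k + 1)%nat). split; [|lra]. split; [eexists; reflexivity|].
    apply (cluster_le _ g _ a k Hgc). intros n Hn. left. apply Yf. lia.
  - exists (y (2 * k + 2)%nat). split; [|lra]. split; [eexists; reflexivity|].
    apply (cluster_ge _ g _ b k Hgc). intros n Hn. left. apply Yf. lia.
Qed.

(** * Borel measurability and the passage to all rational pairs *)

Lemma borel_fun_lt {X : Type} (d : X -> X -> R) f a :
  borel_fun d f -> borel d (fun x => f x < a).
Proof.
  intros H. apply borel_ext with (fun x => exists n, a - INR n < f x < a).
  - apply borel_cunion. intros n. apply H.
  - intros x. split; [intros [n Hn]; lra|]. intros Hx.
    destruct (INR_unbounded (a - f x)) as [n Hn]. exists n. lra.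
Qed.

Lemma borel_fun_gt {X : Type} (d : X -> X -> R) f b :
  borel_fun d f -> borel d (fun x => f x > b).
Proof.
  intros H. apply borel_ext with (fun x => exists n, b < f x < b + INR n).
  - apply borel_cunion. intros n. apply H.
  - intros x. split; [intros [n Hn]; lra|]. intros Hx.
    destruct (INR_unbounded (f x - b)) as [n Hn]. exists n. lra.
Qed.

Lemma borel_cinter {X : Type} (d : X -> X -> R) (A : nat -> X -> Prop) :
  (forall n, borel d (A n)) -> borel d (fun x => forall n, A n x).
Proof.
  intros H. apply borel_ext with (fun x => ~ exists n, ~ A n x).
  - apply borel_compl, borel_cunion. intros n. apply borel_compl, H.
  - intros x. split.
    + intros Hn n. apply NNPP. intros Hc. apply Hn. exists n; exact Hc.
    + intros Hn [n Hc]. exact (Hc (Hn n)).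
Qed.

(** The margin [/ INR (S k)] lets strict inequalities for all late [h n] pass to the limit, giving a
    countable combination of open sets. *)
Lemma baire1_borel {X : Type} (d : X -> X -> R) f : baire1 d f -> borel_fun d f.
Proof.
  intros [h [Hc Hl]] a b.
  apply borel_ext with (fun x => exists k, exists N, forall n,
    (n >= N)%nat -> a + / INR (S k) < h n x < b - / INR (S k)).
  - apply borel_cunion; intros k. apply borel_cunion; intros N.
    apply borel_cinter; intros n. apply borel_open. intros x Hx.
    destruct (Compare_dec.le_dec N n) as [Hn|Hn].
    2: { exists 1. split; [lra|]. intros y _ Hge. lia. }
    specialize (Hx Hn).
    set (e := Rmin (h n x - (a + / INR (S k))) (b - / INR (S k) - h n x)).
    pose proof (Rmin_l (h n x - (a + / INR (S k))) (b - / INR (S k) - h n x)).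
    pose proof (Rmin_r (h n x - (a + / INR (S k))) (b - / INR (S k) - h n x)).
    destruct (Hc n x e) as [del [Hdel Hball]]; [unfold e; apply Rmin_glb_lt; lra|].
    exists del. split; [exact Hdel|]. intros y Hy _.
    specialize (Hball y Hy). apply Rabs_def2 in Hball. fold e in H, H0. lra.
  - intros x. split.
    + intros [k [N HN]]. pose proof (inv_INR_S_pos k).
      destruct (Hl x (/ INR (S k)) H) as [M HM].
      specialize (HN (N + M)%nat ltac:(lia)). specialize (HM (N + M)%nat ltac:(lia)).
      unfold Rdist in HM. apply Rabs_def2 in HM. lra.
    + intros Hx.
      set (e := Rmin (f x - a) (b - f x)).
      pose proof (Rmin_l (f x - a) (b - f x)). pose proof (Rmin_r (f x - a) (b - f x)).
      assert (He : e > 0) by (unfold e; apply Rmin_glb_lt; lra). fold e in H, H0.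
      destruct (inv_INR_S_small (e / 2)) as [k Hk]; [lra|].
      destruct (Hl x (e / 2)) as [N HN]; [lra|].
      exists k, N. intros n Hn. specialize (HN n Hn).
      unfold Rdist in HN. apply Rabs_def2 in HN. lra.
Qed.

Definition nat_to_Q (n : nat) : Q :=
  let (i, r) := of_nat n in let (j, p) := of_nat r in
  Qmake (Z.of_nat i - Z.of_nat j) (Pos.of_nat p).

Lemma nat_to_Q_surj (q : Q) : exists n, nat_to_Q n = q.
Proof.
  destruct q as [z p].
  exists (to_nat (Z.to_nat z, to_nat (Z.to_nat (- z), Pos.to_nat p))).
  unfold nat_to_Q. rewrite !cancel_of_to, Pos2Nat.id. f_equal. lia.
Qed.

Lemma uniform_rank_bound {X : Type} (d : X -> X -> R) (Hpolish : is_polish d)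
  (f : nat -> X -> R) (T : nat -> nat -> Prop) (G : (X -> R) -> Prop) :
  (forall n, borel_fun d (f n)) ->
  approximable f T G ->
  (forall n : nat -> nat, (forall i j, (i < j)%nat -> T (n i) (n j)) ->
     exists g, baire1 d g /\ cluster (fun j => f (n j)) g) ->
  exists xi, forall g, G g -> alpha_le d g xi.
Proof.
  intros Hf HG Hcl.
  assert (A : forall q : Q * Q, exists xi, (fst q < snd q)%Q -> forall g, G g ->
     forall x, ~ sep_iter d g (Q2R (fst q)) (Q2R (snd q)) xi x).
  { intros [a b]; simpl. destruct (Qlt_le_dec a b) as [Hab|Hab].
    - destruct (uniform_rank_bound_at d Hpolish f T G (Q2R a) (Q2R b)) as [xi Hxi]; auto.
      + apply Qlt_Rlt. exact Hab.
      + intros n. apply borel_fun_lt, Hf.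
      + intros n. apply borel_fun_gt, Hf.
      + exists xi. intros _. exact Hxi.
    - exists OZ. intros Hlt. exfalso. apply (Qlt_not_le _ _ Hlt Hab). }
  destruct (functional_choice _ A) as [xi Hxi].
  (* A supremum over all pairs of rationals: its derived set is contained in that of each
     [xi (a, b)]. *)
  exists (OL (fun i => OL (fun j => xi (nat_to_Q i, nat_to_Q j)))).
  intros g Hg a b Hab x Hx. simpl in Hx.
  destruct (nat_to_Q_surj a) as [i Hi]. destruct (nat_to_Q_surj b) as [j Hj].
  specialize (Hx i j). rewrite Hi, Hj in Hx. exact (Hxi (a, b) Hab g Hg x Hx).
Qed.

(** * Compactness and accumulation points *)

(** Otherwise [K] is covered by the open sets of functions with a neighbourhood missed by [h n] for
    all [n >= N]. For a finite subcover [L], the function [h (list_max L)] would miss a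
    neighbourhood of itself. *)
Lemma pw_compact_cluster {X : Type} (K : (X -> R) -> Prop) (h : nat -> X -> R) :
  pw_compact K -> (forall n, K (h n)) -> exists g, K g /\ cluster h g.
Proof.
  intros HK Hh. apply NNPP. intros Hn.
  destruct (HK nat (fun N g => exists l eps, eps > 0 /\
     forall n, (n >= N)%nat -> ~ pw_nbhd g l eps (h n))) as [L HL].
  - intros N g (l & eps & He & H). exists l, (eps / 2). split; [lra|].
    intros g' Hg'. exists l, (eps / 2). split; [lra|]. intros n Hge Hnb.
    apply (H n Hge). intros x Hx. specialize (Hg' x Hx). specialize (Hnb x Hx).
    replace (h n x - g x) with ((h n x - g' x) + (g' x - g x)) by ring.
    eapply Rle_lt_trans; [apply Rabs_triang|lra].
  - intros g Hg. apply NNPP. intros Hc. apply Hn. exists g. split; [exact Hg|].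
    intros l eps N He. apply NNPP. intros Hcl. apply Hc. exists N, l, eps.
    split; [exact He|]. intros n Hge Hnb. apply Hcl. exists n. split; assumption.
  - destruct (HL (h (list_max L)) (Hh _)) as [N [HN (l & eps & He & H)]].
    apply (H (list_max L)).
    + apply (proj1 (Forall_forall _ _) (proj1 (list_max_le L _) (le_n _))). exact HN.
    + intros x _. rewrite Rminus_diag, Rabs_R0. exact He.
Qed.

Lemma pw_nbhd_separates {X : Type} (h g : X -> R) (l : list X) :
  h <> g -> exists l' eps, eps > 0 /\ incl l l' /\ ~ pw_nbhd g l' eps h.
Proof.
  intros Hne. assert (exists x, h x <> g x) as [x Hx].
  { apply NNPP. intros Hn. apply Hne.
    apply functional_extensionality. intros x.
    apply NNPP. intros Hx. apply Hn. exists x; exact Hx. }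
  exists (x :: l), (Rabs (h x - g x)). split; [apply Rabs_pos_lt; lra|].
  split; [apply incl_tl, incl_refl|]. intros H.
  specialize (H x (or_introl eq_refl)). lra.
Qed.

Lemma pw_nbhd_mono {X : Type} (g h : X -> R) l l' eps eps' :
  incl l l' -> eps' <= eps -> pw_nbhd g l' eps' h -> pw_nbhd g l eps h.
Proof. intros Hl He H x Hx. specialize (H x (Hl x Hx)). lra. Qed.

Lemma pw_nbhd_avoid {X : Type} (h : nat -> X -> R) (g : X -> R) (k : nat) l eps :
  eps > 0 -> exists l' eps', eps' > 0 /\ eps' <= eps /\ incl l l' /\
    forall i, (i < k)%nat -> h i <> g -> ~ pw_nbhd g l' eps' (h i).
Proof.
  intros He. induction k as [|k (l1 & e1 & H1 & H2 & H3 & H4)].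
  - exists l, eps. repeat split; auto; [lra|apply incl_refl|intros; lia].
  - destruct (classic (h k = g)) as [Heq|Hne].
    + exists l1, e1. repeat split; auto. intros i Hi Hig.
      destruct (Nat.eq_dec i k) as [->|]; [contradiction|]. apply H4; [lia|exact Hig].
    + destruct (pw_nbhd_separates (h k) g l1 Hne) as (l2 & e2 & P1 & P2 & P3).
      pose proof (Rmin_l e1 e2). pose proof (Rmin_r e1 e2).
      exists l2, (Rmin e1 e2). split; [apply Rmin_glb_lt; lra|].
      split; [lra|]. split; [eapply incl_tran; eassumption|].
      intros i Hi Hig Hnb. destruct (Nat.eq_dec i k) as [->|].
      * apply P3. revert Hnb. apply pw_nbhd_mono; [apply incl_refl|lra].
      * apply (H4 i); [lia|exact Hig|]. revert Hnb. apply pw_nbhd_mono; [exact P2|lra].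
Qed.

(** Take [h <> g] in the closure near [g], then [f p] so near [h] that it still differs from [g].
    The neighbourhood of [g] excludes the earlier selections other than [g], so [f p] is new. *)
Lemma pw_acc_closure_approximable {X : Type} (f : nat -> X -> R) :
  approximable f (fun i p => f i <> f p)
    (pw_acc (pw_closure (fun h => exists n, h = f n))).
Proof.
  intros g Hg n k l eps He.
  destruct (pw_nbhd_avoid (fun i => f (n i)) g k l eps He) as (l1 & e1 & H1 & H2 & H3 & H4).
  destruct (Hg l1 (e1 / 2)) as (h & Hh & Hne & Hnb); [lra|].
  destruct (pw_nbhd_separates h g l1 Hne) as (l2 & e2 & P1 & P2 & P3).
  pose proof (Rmin_l (e1 / 2) e2) as M1. pose proof (Rmin_r (e1 / 2) e2) as M2.
  assert (exists x, In x l2 /\ Rabs (h x - g x) >= e2) as [x [Hx Hhx]].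
  { apply NNPP. intros Hc. apply P3. intros x Hx. apply Rnot_ge_lt. intros Hge.
    apply Hc. exists x; split; assumption. }
  destruct (Hh l2 (Rmin (e1 / 2) e2)) as (h' & [p ->] & Hp); [apply Rmin_glb_lt; lra|].
  assert (Hpg : pw_nbhd g l1 e1 (f p)).
  { intros y Hy. specialize (Hnb y Hy). specialize (Hp y (P2 y Hy)).
    replace (f p y - g y) with ((f p y - h y) + (h y - g y)) by ring.
    eapply Rle_lt_trans; [apply Rabs_triang|lra]. }
  assert (Hpne : f p <> g).
  { intros Heq. specialize (Hp x Hx). rewrite Heq, Rabs_minus_sym in Hp. lra. }
  exists p. split.
  - intros i Hi Heq. apply (H4 i Hi); rewrite Heq; assumption.
  - revert Hpg. apply pw_nbhd_mono; assumption.
Qed.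

(** At most one term equals [g]; if the term found does, a later one in the same neighbourhood does
    not. *)
Lemma cluster_distinct_acc {X : Type} (K : (X -> R) -> Prop) (h : nat -> X -> R) g :
  (forall n, K (h n)) -> (forall i j, (i < j)%nat -> h i <> h j) ->
  cluster h g -> pw_acc K g.
Proof.
  intros HK Hd Hcl l eps He.
  destruct (Hcl l eps O He) as [i [_ Hi]].
  destruct (classic (h i = g)) as [Heq|Hne]; [|exists (h i); auto].
  destruct (Hcl l eps (S i) He) as [j [Hj Hjn]].
  exists (h j). split; [apply HK|]. split; [|exact Hjn].
  rewrite <- Heq. intros E. apply (Hd i j); [lia|congruence].
Qed.

Lemma pw_closure_incl {X : Type} (S : (X -> R) -> Prop) g : S g -> pw_closure S g.
Proof.
  intros H l eps He. exists g. split; [exact H|].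
  intros x _. rewrite Rminus_diag, Rabs_R0. exact He.
Qed.

Theorem theorem4p8 (X : Type) (d : X -> X -> R) (Hpolish : is_polish d) :
  (forall f : nat -> X -> R,
     (forall n, borel_fun d (f n)) ->
     pw_compact (pw_closure (fun h => exists n, h = f n)) ->
     (forall g, pw_acc (pw_closure (fun h => exists n, h = f n)) g -> baire1 d g) ->
     exists xi : cord, forall g,
       pw_acc (pw_closure (fun h => exists n, h = f n)) g -> alpha_le d g xi)
  /\
  (forall K : (X -> R) -> Prop,
     rosenthal_compact d K -> pw_separable K ->
     exists xi : cord, forall g, K g -> alpha_le d g xi).
Proof.
  split.
  - intros f Hf HK Hacc.
    (* Pairwise distinct selections force every cluster function into the accumulation points, where
       Baire-1 is assumed. *)
    apply (uniform_rank_bound d Hpolish f (fun i p => f i <> f p) _ Hf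
      (pw_acc_closure_approximable f)).
    intros n Hn.
    assert (Hin : forall j, pw_closure (fun h => exists n, h = f n) (f (n j))).
    { intros j. apply pw_closure_incl. exists (n j); reflexivity. }
    destruct (pw_compact_cluster _ (fun j => f (n j)) HK Hin) as [g [_ Hg]].
    exists g. split; [|exact Hg]. apply Hacc.
    exact (cluster_distinct_acc _ (fun j => f (n j)) g Hin Hn Hg).
  - intros K [HB HK] [s [Hs Hdense]].
    (* Here selections are unrestricted: compactness gives a cluster function in [K], and all
       members of [K] are Baire-1. *)
    apply (uniform_rank_bound d Hpolish s (fun _ _ => True)).
    + intros n. apply baire1_borel, HB, Hs.
    + intros g Hg n k l eps He.
      destruct (Hdense g Hg l eps He) as (h & [p ->] & Hp). exists p. auto.
    + intros n _.
      destruct (pw_compact_cluster K (fun j => s (n j)) HK (fun j => Hs _)) as [g [HgK Hg]].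
      exists g. auto.
Qed.
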